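(* Let $X$ be a Hadamard space, $C\subseteq X$ closed and convex, and let $T_k:C\to C$ ($k\ge 1$) be a strongly quasi-nonexpansive sequence satisfying the demiclosedness condition (D). Let $u,x_1\in C$ and let $\{\alpha_k\}\subset(0,1)$ satisfy $\lim_k\alpha_k=0$ and $\sum_{k=1}^{\infty}\alpha_k=+\infty$. Then the sequence $\{x_k\}$ generated by $$x_{k+1}=\alpha_k u\oplus(1-\alpha_k)T_kx_k\qquad(k\ge1)$$ converges strongly (i.e. in the metric) to $\mathrm{Proj}_{\bigcap_kF(T_k)}u$.
   Context: A Hadamard space is a complete CAT(0) space. $(1-t)x\oplus ty$ denotes the unique point $z$ of the geodesic segment $[x,y]$ with $d(x,z)=t\,d(x,y)$ and $d(y,z)=(1-t)d(x,y)$. $\mathrm{Proj}_S u$ is the nearest point of a nonempty closed convex set $S$ to $u$. For a bounded sequence $\{x_k\}$ the asymptotic center is the set of minimizers over $x\in X$ of $\limsup_k d(x,x_k)$. $\{x_k\}$ $\Delta$-converges to $x$ if every subsequence of $\{x_k\}$ has asymptotic center $\{x\}$. $F(T)=\{x\in C: Tx=x\}$. $T:C\to C$ is quasi-nonexpansive if $F(T)\ne\varnothing$ and $d(Tx,q)\le d(x,q)$ for all $x\in C$, $q\in F(T)$. A sequence $\{T_k\}$ of quasi-nonexpansive mappings $C\to C$ is a strongly quasi-nonexpansive sequence if $\bigcap_kF(T_k)\neq\varnothing$ and $d(x_k,T_kx_k)\to 0$ whenever $\{x_k\}$ is a bounded sequence in $C$ such that $d(x_k,q)-d(T_kx_k,q)\to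 0$ for some $q\in\bigcap_kF(T_k)$. Condition (D): for every sequence $\{x_k\}$ in $C$ and every strictly increasing sequence of indices $\{k_j\}$, if $x_{k_j}$ $\Delta$-converges to $p\in C$ and $\lim_j d(x_{k_j},T_{k_j}x_{k_j})=0$, then $p\in\bigcap_kF(T_k)$. *)

(* Defs.v *)
From HB Require Import structures.
From mathcomp Require Import all_boot all_order all_algebra.
From mathcomp Require Import all_classical all_reals all_analysis.

Set Implicit Arguments.
Unset Strict Implicit.
Unset Printing Implicit Defensive.

Import Order.TTheory GRing.Theory Num.Theory.
Import numFieldNormedType.Exports.

Local Open Scope classical_set_scope.
Local Open Scope ring_scope.

#[short(type="completeMetricType")]
HB.structure Definition CompleteMetric (K : numDomainType) :=
  { M of Metric K M & Complete M }.

Section CAT0.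
Context {R : realType}.

Section Geodesics.
Context {X : metricType R}.
Implicit Types (x y z : X) (A C : set X).

(* The parameter interval is forced to be [0, d(x, y)]; the values of [c]
   outside of it are irrelevant. *)
Definition geodesic_segment x y A : Prop :=
  exists c : R -> X,
    [/\ c 0 = x, c (mdist x y) = y,
        {in `[0, mdist x y] &, forall s t, mdist (c s) (c t) = `|s - t|}
      & A = c @` `[0, mdist x y]].

Definition geodesically_convex C : Prop :=
  forall x y A, C x -> C y -> geodesic_segment x y A -> A `<=` C.

(* [comb t x y z] reads z = (1 - t) x (+) t y. *)
Definition comb (t : R) x y z : Prop :=
  [/\ exists2 A, geodesic_segment x y A & A z,
      mdist x z = t * mdist x y & mdist y z = (1 - t) * mdist x y].

End Geodesics.

(* The library norm on 'rV_2 is the max norm, hence this explicit distance. *)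
Definition edist (a b : 'rV[R]_2) : R :=
  Num.sqrt (\sum_i (a ord0 i - b ord0 i) ^+ 2).

Section Comparison.
Context {X : metricType R}.

(* [x'] is the point of the Euclidean segment [p', q'] that corresponds to the
   point [x] of the side [A], which joins [p] to [q]. *)
Definition comparison_point (p : X) (A : set X) (p' q' : 'rV[R]_2)
    (x : X) (x' : 'rV[R]_2) : Prop :=
  [/\ A x, exists2 s, s \in `[0, 1] & x' = (1 - s) *: p' + s *: q'
    & edist p' x' = mdist p x].

End Comparison.

Definition cat0 (X : metricType R) : Prop :=
  (forall x y : X, exists A, geodesic_segment x y A) /\
  (forall (p q r : X) (A B C : set X) (p' q' r' : 'rV[R]_2),
    geodesic_segment p q A -> geodesic_segment q r B ->
    geodesic_segment r p C ->
    edist p' q' = mdist p q -> edist q' r' = mdist q r ->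
    edist r' p' = mdist r p ->
    let comparison x x' :=
      [\/ comparison_point p A p' q' x x', comparison_point q B q' r' x x'
        | comparison_point r C r' p' x x'] in
    forall x y x' y', comparison x x' -> comparison y y' ->
      mdist x y <= edist x' y').

End CAT0.

Section Sequences.
Context {R : realType} {X : metricType R}.
Implicit Types (C S : set X) (T : X -> X) (Ts : nat -> X -> X).

Definition bounded_seq (x : nat -> X) : Prop :=
  exists (a : X) (M : R), forall k, mdist a (x k) <= M.

(* Extended-real valued, so that it is meaningful without boundedness. *)
Definition asymptotic_radius (x : nat -> X) (z : X) : \bar R :=
  limn_esup (fun k => (mdist z (x k))%:E).

Definition asymptotic_center (x : nat -> X) : set X :=
  [set z | forall y, (asymptotic_radius x z <= asymptotic_radius x y)%E].

Definition strictly_increasing (phi : nat -> nat) : Prop :=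
  {homo phi : i j / (i < j)%N}.

Definition Delta_cvg (x : nat -> X) (p : X) : Prop :=
  bounded_seq x /\
  forall phi, strictly_increasing phi ->
    asymptotic_center (x \o phi) = [set p].

Definition fix_set C T : set X := [set x | C x /\ T x = x].

Definition common_fix_set C Ts : set X := \bigcap_k fix_set C (Ts k).

Definition quasi_nonexpansive C T : Prop :=
  [/\ forall x, C x -> C (T x), fix_set C T !=set0
    & forall x q, C x -> fix_set C T q -> mdist (T x) q <= mdist x q].

Definition strongly_quasi_nonexpansive_seq C Ts : Prop :=
  [/\ forall k, quasi_nonexpansive C (Ts k), common_fix_set C Ts !=set0
    & forall x : nat -> X, (forall k, C (x k)) -> bounded_seq x ->
      (exists2 q, common_fix_set C Ts q &
        (mdist (x k) q - mdist (Ts k (x k)) q) @[k --> \oo] --> (0 : R)) ->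
      mdist (x k) (Ts k (x k)) @[k --> \oo] --> (0 : R)].

Definition demiclosedness_condition C Ts : Prop :=
  forall (x : nat -> X) (phi : nat -> nat) (p : X),
    (forall k, C (x k)) -> strictly_increasing phi ->
    C p -> Delta_cvg (x \o phi) p ->
    mdist (x (phi j)) (Ts (phi j) (x (phi j))) @[j --> \oo] --> (0 : R) ->
    common_fix_set C Ts p.

(* [p] is the unique nearest point of [S] to [u]. *)
Definition is_proj S (u p : X) : Prop :=
  [set q | S q /\ forall y, S y -> mdist u q <= mdist u y] = [set p].

End Sequences.

(* Main.v *)
(** In a CAT(0) space the comparison triangle yields the (CN) inequality
    [d(w, z)^2 <= (1 - t) d(w, x)^2 + t d(w, y)^2 - t (1 - t) d(x, y)^2] for
    [z = (1 - t) x (+) t y], and everything else follows from it: functions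
    satisfying (CN) have minimizers on closed convex sets (hence projections and
    asymptotic centers), bounded sequences have Delta-convergent subsequences,
    and closed convex sets contain the Delta-limits of their sequences.  With [p]
    the projection of [u] and [s k = d(x k, p)^2], (CN) gives
    [s (k+1) <= (1 - alpha k) s k + alpha k * b k] where
    [b k = d(u, p)^2 - (1 - alpha k) d(u, T k (x k))^2].  It suffices that
    [b k] is eventually small along those [k] where [s] hardly decreases: there
    [d(x k, T k (x k))] tends to [0], so by (D) the Delta-limits [q] are common
    fixed points, while [b k >= e > 0] would force [d(u, q) < d(u, p)]. *)

Require Import Defs.
From HB Require Import structures.
From mathcomp Require Import all_boot all_order all_algebra.
From mathcomp Require Import all_classical all_reals all_analysis.
From mathcomp Require Import ring lra.

Set Implicit Arguments.
Unset Strict Implicit.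
Unset Printing Implicit Defensive.

Import Order.TTheory GRing.Theory Num.Theory.
Import numFieldNormedType.Exports.

Local Open Scope classical_set_scope.
Local Open Scope ring_scope.

(* Unqualified, [edist] is the library's extended distance. *)
Local Notation edist := Defs.edist.

(** * Comparison triangles in the Euclidean plane *)

Definition plane_point {R : realType} (a b : R) : 'rV[R]_2 :=
  \row_(i < 2) if i == ord0 then a else b.

Lemma edist_plane {R : realType} (a b c d : R) :
  edist (plane_point a b) (plane_point c d) =
  Num.sqrt ((a - c) ^+ 2 + (b - d) ^+ 2).
Proof. by rewrite /edist big_ord_recl big_ord1 !mxE. Qed.

(** With [p] at the origin and [q] at [(a, 0)], the law of cosines gives the first coordinate [x] of
    [r], and the triangle inequalities leave room for the second one. The last clause is Stewart's
    theorem. *)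
Lemma comparison_triangle (R : realType) (a b c : R) :
  0 < a -> 0 <= b -> 0 <= c -> a <= b + c -> b <= a + c -> c <= a + b ->
  exists p q r : 'rV[R]_2,
    [/\ edist p q = a, edist q r = b, edist r p = c &
      forall t, 0 <= t -> edist p ((1 - t) *: p + t *: q) = t * a /\
        edist ((1 - t) *: p + t *: q) r ^+ 2 =
        (1 - t) * c ^+ 2 + t * b ^+ 2 - t * (1 - t) * a ^+ 2].
Proof.
move=> a0 b0 c0 abc bac cab.
pose x := (a ^+ 2 + c ^+ 2 - b ^+ 2) / (2 * a).
have a2 : 2 * a != 0 by rewrite mulf_neq0 ?pnatr_eq0// gt_eqF.
have xE : x * (2 * a) = a ^+ 2 + c ^+ 2 - b ^+ 2 by rewrite mulfVK.
(* Multiplied by [2 * a], the factors [c - x] and [c + x] become [b ^+ 2 - (a - c) ^+ 2] and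
   [(a + c) ^+ 2 - b ^+ 2]. *)
have h0 : 0 <= c ^+ 2 - x ^+ 2.
  rewrite subr_sqr mulr_ge0//.
    by rewrite -(pmulr_lge0 _ (x := 2 * a)) ?mulrBl ?xE; nra.
  by rewrite -(pmulr_lge0 _ (x := 2 * a)) ?mulrDl ?xE; nra.
pose y := Num.sqrt (c ^+ 2 - x ^+ 2).
have yE : y ^+ 2 = c ^+ 2 - x ^+ 2 by rewrite sqr_sqrtr.
have combE t : (1 - t) *: plane_point 0 0 + t *: plane_point a 0 =
    plane_point (t * a) 0.
  by apply/rowP => i; rewrite !mxE; case: ifP => _; rewrite !mulr0 add0r.
exists (plane_point 0 0), (plane_point a 0), (plane_point x y).
have sqrtE (u v : R) : 0 <= v -> u = v ^+ 2 -> Num.sqrt u = v.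
  by move=> v0 ->; rewrite sqrtr_sqr ger0_norm.
split; rewrite ?edist_plane.
- by apply: sqrtE; [exact: ltW | ring].
- by apply: sqrtE => //; rewrite sub0r sqrrN yE; lra.
- by apply: sqrtE => //; rewrite !subr0 yE; lra.
- move=> t t0; rewrite combE !edist_plane; split.
    by apply: sqrtE; [rewrite mulr_ge0// ltW | ring].
  rewrite sqr_sqrtr ?addr_ge0 ?sqr_ge0// sub0r sqrrN yE.
  have -> : b ^+ 2 = a ^+ 2 + c ^+ 2 - x * (2 * a) by rewrite xE; ring.
  ring.
Qed.

(** * Convexity in CAT(0) spaces *)

Section CN.
Context {R : realType} {X : metricType R}.
Implicit Types (x y z w : X) (S : set X) (t : R).

Lemma mdist_le0 x y : mdist x y <= 0 -> x = y.
Proof.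
by move=> d; apply: mdist_positivity; apply/eqP; rewrite eq_le d mdist_ge0.
Qed.

(* In a CAT(0) space with [0 <= t <= 1] this characterizes
   [z = (1 - t) x (+) t y]. *)
Definition cn_point t x y z : Prop := forall w,
  mdist w z ^+ 2 <=
  (1 - t) * mdist w x ^+ 2 + t * mdist w y ^+ 2 - t * (1 - t) * mdist x y ^+ 2.

Definition cn_convex S : Prop := forall t x y z,
  0 <= t <= 1 -> S x -> S y -> cn_point t x y z -> S z.

(** In the triangle [x], [y], [w], the point [z] of the side [A] is compared with the opposite
    vertex [w]; Stewart's theorem evaluates the Euclidean distance. The case [x = y] is separate
    because the comparison triangle needs a base of positive length. *)
Lemma geodesic_cn_point (HX : cat0 X) t x y z (A : set X) :
  0 <= t <= 1 -> geodesic_segment x y A -> A z ->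
  mdist x z = t * mdist x y -> cn_point t x y z.
Proof.
move=> /andP[t0 t1] gA Az xz w.
have [xy|xyN] := eqVneq x y.
  move: xz; rewrite -xy mdistxx mulr0 => /mdist_positivity <-.
  by rewrite expr0n/= mulr0 subr0 -mulrDl subrK mul1r.
have d0 : 0 < mdist x y by rewrite mdist_gt0.
have [B gB] := HX.1 y w; have [D gD] := HX.1 w x.
have := @comparison_triangle R (mdist x y) (mdist y w) (mdist w x) d0
  (mdist_ge0 _ _) (mdist_ge0 _ _).
have [xy yw wx] : [/\ mdist x y <= mdist y w + mdist w x,
    mdist y w <= mdist x y + mdist w x & mdist w x <= mdist x y + mdist y w].
  have := (metric_triangle x w y, metric_triangle y x w, metric_triangle w y x).
  rewrite (metric_sym x w) (metric_sym w y) (metric_sym y x).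
  by case=> [[? ?] ?]; split; lra.
move=> /(_ xy yw wx)[p [q [r [pq qr rp comb]]]].
have [pz zr] := comb t t0.
have Bw : B w.
  case: gB => c [c0 c1 _ ->]; exists (mdist y w) => //=.
  by rewrite in_itv/= mdist_ge0 lexx.
have zw : mdist z w <= edist ((1 - t) *: p + t *: q) r.
  apply: (HX.2 x y w A B D p q r gA gB gD pq qr rp).
  - apply: Or31; split; [by []| | by rewrite xz].
    by exists t => //; rewrite in_itv/= t0.
  (* The vertex [w] is the far end of the side [B], hence the parameter 1. *)
  - apply: Or32; split; [by []| | by []].
    by exists 1; rewrite ?in_itv/= ?ler01 ?lexx// subrr scale0r add0r scale1r.
rewrite (metric_sym w z) (metric_sym w y) -zr.
by rewrite lerXn2r ?nnegrE ?mdist_ge0 ?sqrtr_ge0.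
Qed.

Definition cn_space : Prop := forall t x y,
  0 <= t <= 1 -> exists z : X, cn_point t x y z.

(** The model is the squared distance to a fixed point, for which this is the very definition of
    [cn_point]. *)
Definition strongly_convex (f : X -> R) : Prop := forall t x y z,
  0 <= t <= 1 -> cn_point t x y z ->
  f z <= (1 - t) * f x + t * f y - t * (1 - t) * mdist x y ^+ 2.

Lemma geodesic_point t x y (A : set X) : 0 <= t <= 1 ->
  geodesic_segment x y A -> exists2 z, A z & mdist x z = t * mdist x y.
Proof.
move=> /andP[t0 t1] [c [c0 c1 cd ->]].
have tI : t * mdist x y \in `[0, mdist x y].
  by rewrite in_itv/= mulr_ge0 ?mdist_ge0//= ler_piMl ?mdist_ge0.
exists (c (t * mdist x y)); first by exists (t * mdist x y).
rewrite -{1}c0 cd ?in_itv/= ?lexx ?mdist_ge0// sub0r normrN ger0_norm//.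
by rewrite mulr_ge0 ?mdist_ge0.
Qed.

Lemma cat0_cn_space : cat0 X -> cn_space.
Proof.
move=> HX t x y t01; have [A gA] := HX.1 x y.
have [z Az zE] := geodesic_point t01 gA.
by exists z; exact: geodesic_cn_point gA Az zE.
Qed.

(** (CN) for [z], tested at the endpoints, gives [d(x, z) <= t d(x, y)] and
    [d(y, z) <= (1 - t) d(x, y)]. Inserted in (CN) for [w], tested at [z], these make the right-hand
    side at most 0. *)
Lemma cn_point_uniq t x y z w : 0 <= t <= 1 ->
  cn_point t x y z -> cn_point t x y w -> z = w.
Proof.
move=> /andP[t0 t1] Hz Hw; apply: mdist_le0.
rewrite -(@ler_pXn2r _ 2) ?nnegrE ?mdist_ge0// expr0n/=.
have zx := Hz x; have zy := Hz y; have := Hw z.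
move: zx zy; rewrite !mdistxx (metric_sym y x) (metric_sym z x) (metric_sym z y).
move: (mdist x z ^+ 2) (mdist y z ^+ 2) (mdist x y ^+ 2) => a b c.
rewrite expr0n/= => h1 h2 h3; apply: (le_trans h3).
have : (1 - t) * a <= (1 - t) * ((1 - t) * 0 + t * c - t * (1 - t) * c).
  by rewrite ler_wpM2l// subr_ge0.
have : t * b <= t * ((1 - t) * c + t * 0 - t * (1 - t) * c).
  by rewrite ler_wpM2l.
lra.
Qed.

(** By uniqueness, a (CN) point of [x] and [y] is the point of a geodesic segment with the same
    parameter. *)
Lemma geodesically_convex_cn (HX : cat0 X) S :
  geodesically_convex S -> cn_convex S.
Proof.
move=> cS t x y z t01 Sx Sy zP; have [A gA] := HX.1 x y.
have [w Aw wE] := geodesic_point t01 gA.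
rewrite (cn_point_uniq t01 zP (geodesic_cn_point HX t01 gA Aw wE)).
exact: cS gA _ Aw.
Qed.

Lemma comb_cn_point (HX : cat0 X) t x y z :
  0 <= t <= 1 -> comb t x y z -> cn_point t x y z.
Proof. by move=> t01 [[A gA Az] xz _]; exact: geodesic_cn_point gA Az xz. Qed.

Lemma cn_convex_ball (u : X) (r : R) : cn_convex [set z | mdist u z <= r].
Proof.
move=> t x y z /andP[t0 t1]/= ux uy /(_ u) zP.
have r0 : 0 <= r by apply: le_trans ux; exact: mdist_ge0.
rewrite -(@ler_pXn2r _ 2) ?nnegrE ?mdist_ge0//; apply: (le_trans zP).
have h x' : mdist u x' <= r -> mdist u x' ^+ 2 <= r ^+ 2.
  by move=> ?; rewrite ler_pXn2r ?nnegrE ?mdist_ge0.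
have := ler_wpM2l (_ : 0 <= 1 - t) (h _ ux); have := ler_wpM2l t0 (h _ uy).
have : 0 <= t * (1 - t) * mdist x y ^+ 2.
  by rewrite !mulr_ge0 ?subr_ge0 ?mdist_ge0.
rewrite subr_ge0 => + + /(_ t1); lra.
Qed.

Lemma closed_ball_mdist (u : X) (r : R) : closed [set z | mdist u z <= r].
Proof.
move=> z cz /=; apply/ler_addgt0Pr => e e0.
have [w [/= uw]] := cz _ (nbhsx_ballx z e e0).
rewrite ballEmdist/= => zw; apply: (le_trans (metric_triangle u w z)).
by rewrite lerD// metric_sym ltW.
Qed.

Lemma closed_sqr_le (f : X -> R) : (forall z, 0 <= f z) ->
  (forall c, closed [set z | f z <= c]) ->
  forall c, closed [set z | f z ^+ 2 <= c].
Proof.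
move=> f0 fc c; have [c0|c0] := leP 0 c.
  rewrite (_ : [set z | _] = [set z | f z <= Num.sqrt c]); first exact: fc.
  apply/eq_set => z; congr is_true; rewrite -{1}(sqr_sqrtr c0).
  by rewrite ler_pXn2r ?nnegrE ?sqrtr_ge0.
rewrite (_ : [set z | _] = set0); first exact: closed0.
rewrite -subset0 => z /= /le_lt_trans /(_ c0).
by rewrite ltNge exprn_ge0.
Qed.

Lemma closed_cvg_mem S (z : X^nat) (p : X) : closed S ->
  (\forall n \near \oo, S (z n)) -> z n @[n --> \oo] --> p -> S p.
Proof. by move=> cS nS; exact: closed_cvg. Qed.

End CN.

(** * Minimizers of strongly convex functions *)

Section Minimizer.
Context {R : realType} {X : completeMetricType R}.

(** A minimizing sequence is Cauchy by strong convexity at midpoints, and closed sublevel sets make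
    its limit [p] a minimizer. Comparing [p] with points near it in the direction of [y] yields the
    quadratic growth. *)
Lemma strongly_convex_min (S : set X) (f : X -> R) :
  @cn_space R X -> closed S -> cn_convex S -> S !=set0 ->
  (forall z, 0 <= f z) -> (forall c, closed [set z | f z <= c]) ->
  strongly_convex f ->
  exists2 p, S p & forall y, S y -> f p + mdist p y ^+ 2 <= f y.
Proof.
move=> cnX cS convS [a Sa] f0 fc fconv.
pose r := inf (f @` S).
have hinf : has_inf (f @` S).
  by split; [exists (f a), a | exists 0 => _ [z _ <-]].
have rle y : S y -> r <= f y by move=> Sy; apply: ge_inf; [exact: hinf.2|exists y].
have ex (n : nat) : exists z, S z /\ f z < r + n.+1%:R^-1.
  have n0 : 0 < n.+1%:R^-1 :> R by rewrite invr_gt0 ltr0n.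
  by have [_ [z Sz <-] zlt] := inf_adherent n0 hinf; exists z.
have [z zP] := choice ex.
have zle N n : (N <= n)%N -> f (z n) <= r + N.+1%:R^-1.
  move=> Nn; apply: (le_trans (ltW (zP n).2)); rewrite lerD2l.
  by rewrite lef_pV2 ?posrE ?ltr0n// ler_nat.
(* The midpoint [m] satisfies [r <= f m <= r + 1 / (N + 1) - d(z N, z n)^2 / 4]. *)
have dle N n : (N <= n)%N -> mdist (z N) (z n) ^+ 2 <= 4 * N.+1%:R^-1.
  move=> Nn.
  have h01 : 0 <= (2^-1 : R) <= 1 by lra.
  have [m mP] := cnX _ (z N) (z n) h01.
  have Sm : S m by exact: convS h01 (zP _).1 (zP _).1 mP.
  have := fconv _ _ _ _ h01 mP; have := rle _ Sm.
  have := zle N n Nn; have := zle N N (leqnn _).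
  move: (f m) (f (z n)) (f (z N)) (_ ^+ 2) (_^-1) => a1 a2 a3 a4 a5.
  lra.
have zc : cauchy (z n @[n --> \oo]).
  apply: cauchy_exP => e e0.
  have e4 : 0 < e ^+ 2 / 4 by rewrite divr_gt0 ?exprn_gt0.
  have [N _ NP] := near_infty_natSinv_lt (PosNum e4).
  exists (z N); exists N => // n /= Nn; rewrite ballEmdist/=.
  rewrite -(@ltr_pXn2r _ 2) ?nnegrE ?mdist_ge0 ?ltW//.
  apply: (le_lt_trans (dle _ _ Nn)).
  have := NP N (leqnn _); rewrite /=; move: (_^-1) => ?; lra.
have [p zp] := (cvg_ex _).1 (cauchy_cvg _ zc).
have Sp : S p by apply: closed_cvg_mem zp => //; near=> n; exact: (zP n).1.
have fp : f p <= r.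
  apply/ler_addgt0Pr => e e0.
  have [N _ NP] := near_infty_natSinv_lt (PosNum e0).
  apply: (closed_cvg_mem (fc (r + e)) _ zp); exists N => // n /= Nn.
  by apply: (le_trans (zle _ _ Nn)); rewrite lerD2l ltW// NP/=.
exists p => // y Sy; apply/ler_addgt0Pr => e e0.
pose D := mdist p y ^+ 2; have D0 : 0 <= D by rewrite exprn_ge0 ?mdist_ge0.
(* Dividing the convexity inequality by [t > 0] leaves [f p + (1 - t) D <= f y]; this [t] keeps the
   error [t D] below [e]. *)
pose t := e / (e + D).
have eD : 0 < e + D by lra.
have t0 : 0 < t by rewrite divr_gt0.
have t1 : t <= 1 by rewrite ler_pdivrMr//; lra.
have tD : t * D <= e.
  by rewrite /t mulrAC ler_pdivrMr// ler_wpM2l ?ltW//; lra.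
have [m mP] := cnX t p y (introT andP (conj (ltW t0) t1)).
have fm := fconv _ _ _ _ (introT andP (conj (ltW t0) t1)) mP.
have Sm : S m by apply: convS mP => //; rewrite ltW.
have rm := rle _ Sm.
have : t * (f p + D * (1 - t) - f y) <= 0.
  move: fm; rewrite -/D; lra.
rewrite pmulr_rle0// -/D; lra.
Unshelve. all: by end_near. Qed.

(** The quadratic growth of the squared distance is a Pythagorean inequality; it contains both
    minimality and uniqueness. *)
Lemma nearest_point_exists (S : set X) (u : X) :
  @cn_space R X -> closed S -> cn_convex S -> S !=set0 ->
  exists2 p, S p & forall y, S y ->
    mdist u p ^+ 2 + mdist p y ^+ 2 <= mdist u y ^+ 2.
Proof.
move=> cnX cS convS S0.
apply: (strongly_convex_min (f := fun z => mdist u z ^+ 2)) => //.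
- by move=> z; rewrite exprn_ge0 ?mdist_ge0.
- by apply: closed_sqr_le => [z|c]; [exact: mdist_ge0|exact: closed_ball_mdist].
Qed.

End Minimizer.

(** * Asymptotic centers and Delta-convergence *)

Section AsymptoticRadius.
Context {R : realType} {X : metricType R}.
Implicit Types (y : nat -> X) (z : X) (c : R).

Lemma asymptotic_radius_leP y z c : (asymptotic_radius y z <= c%:E)%E <->
  forall e, 0 < e -> \forall n \near \oo, mdist z (y n) <= c + e.
Proof.
split=> [rc e e0|H].
  have : (asymptotic_radius y z < (c + e)%:E)%E.
    by rewrite (le_lt_trans rc)// lte_fin ltrDl.
  move=> /ereal_inf_lt[_ [V nV <-] supV].
  apply: filterS nV => n Vn; rewrite -lee_fin; apply: (le_trans _ (ltW supV)).
  by apply: ereal_sup_ubound; exists n.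
apply/lee_addgt0Pr => e e0; rewrite -EFinD.
apply: le_trans (ereal_inf_lbound _) _.
  by exists [set n | mdist z (y n) <= c + e]; [exact: H e e0|].
by apply: ge_ereal_sup => _ [n Vn <-]; rewrite lee_fin.
Qed.

Definition asym_radius y z : R := fine (asymptotic_radius y z).

Lemma asymptotic_radiusE y z :
  bounded_seq y -> asymptotic_radius y z = (asym_radius y z)%:E.
Proof.
move=> [a [M yM]].
have : (asymptotic_radius y z <= (mdist z a + M)%:E)%E.
  apply/asymptotic_radius_leP => e e0; near=> n.
  apply: (le_trans (metric_triangle z a _)).
  by rewrite -addrA lerD2l (le_trans (yM n))// lerDl ltW.
rewrite /asym_radius.
(* The value [-oo] is excluded with [c = -1] and [e = 1/2]: some distance would be negative. *)
case: (asymptotic_radius y z) (@asymptotic_radius_leP y z (-1)) => //.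
move=> [/(_ (leNye _))/(_ 2^-1)] + _ _; case=> // N _ /(_ N (leqnn _)) /= H.
by exfalso; have := mdist_ge0 z (y N); lra.
Unshelve. all: by end_near. Qed.

Lemma radius_leP y z c : bounded_seq y -> asym_radius y z <= c <->
  forall e, 0 < e -> \forall n \near \oo, mdist z (y n) <= c + e.
Proof.
by move=> by_; rewrite -asymptotic_radius_leP asymptotic_radiusE// lee_fin.
Qed.

Lemma radius_ge0 y z : bounded_seq y -> 0 <= asym_radius y z.
Proof.
move=> by_; apply/ler_addgt0Pr => e e0.
have [N _ /(_ N (leqnn _)) /= H] :=
  (radius_leP z (asym_radius y z) by_).1 (lexx _) e e0.
exact: le_trans (mdist_ge0 _ _) H.
Qed.

Lemma closed_radius_le y c : bounded_seq y ->
  closed [set z | asym_radius y z <= c].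
Proof.
move=> by_ z cz /=; apply/radius_leP => // e e0.
have e2 : 0 < e / 2 by rewrite divr_gt0.
have [w [/= /(radius_leP _ _ by_)/(_ _ e2) wc]] := cz _ (nbhsx_ballx z _ e2).
rewrite ballEmdist/= => zw; apply: filterS wc => n wn.
by have := metric_triangle z w (y n); lra.
Qed.

(** (CN) is an inequality between squares; this form carries it from the terms of [y] to the upper
    limit. *)
Lemma radius_sqr_leP y z c : bounded_seq y -> asym_radius y z ^+ 2 <= c <->
  forall e, 0 < e -> \forall n \near \oo, mdist z (y n) ^+ 2 <= c + e.
Proof.
move=> by_; have r0 := radius_ge0 z by_; split => [rc e e0|H].
  pose r := asym_radius y z; have {}r0 : 0 <= r := r0.
  (* Chosen so that [(r + d)^2 <= r^2 + d (2 r + 1) <= r^2 + e]. *)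
  pose d := Num.min 1 (e / (2 * r + 1)).
  have d0 : 0 < d by rewrite lt_min ltr01 divr_gt0//; lra.
  have := (radius_leP z r by_).1 (lexx _) d d0; apply: filterS => n nd.
  have : mdist z (y n) ^+ 2 <= (r + d) ^+ 2.
    by rewrite ler_pXn2r ?nnegrE ?mdist_ge0// addr_ge0// ltW.
  move=> /le_trans; apply; rewrite sqrrD -addrA lerD//.
  have d1 : d <= 1 by rewrite ge_min lexx.
  have de : d * (2 * r + 1) <= e.
    by rewrite -ler_pdivlMr ?ge_min ?lexx ?orbT//; lra.
  have : d * d <= d * 1 by rewrite ler_wpM2l// ltW.
  rewrite expr2 -mulr_natr; lra.
have c0 : 0 <= c.
  apply/ler_addgt0Pr => e /H[N _ /(_ N (leqnn _))] /=.
  by apply: le_trans; rewrite exprn_ge0 ?mdist_ge0.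
rewrite -(sqr_sqrtr c0) ler_pXn2r ?nnegrE ?sqrtr_ge0//.
apply/radius_leP => // e e0; have := H (e ^+ 2) (exprn_gt0 _ e0).
apply: filterS => n nd; rewrite -(@ler_pXn2r _ 2) ?nnegrE ?mdist_ge0//; last first.
  by rewrite addr_ge0 ?sqrtr_ge0// ltW.
apply: (le_trans nd); rewrite sqrrD sqr_sqrtr// -addrA lerD2l lerDr.
by rewrite mulrn_wge0// mulr_ge0 ?sqrtr_ge0// ltW.
Qed.

Lemma closed_radius_sqr_le y c : bounded_seq y ->
  closed [set z | asym_radius y z ^+ 2 <= c].
Proof.
move=> by_; apply: closed_sqr_le => [z|b]; first exact: radius_ge0.
exact: closed_radius_le.
Qed.

Lemma radius_sqr_strongly_convex y : bounded_seq y ->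
  strongly_convex (fun z => asym_radius y z ^+ 2).
Proof.
move=> by_ t x x' z /andP[t0 t1] zP; apply/radius_sqr_leP => // e e0.
have h w := (radius_sqr_leP w _ by_).1 (lexx _) e e0.
apply: filterS2 (h x) (h x') => n nx nx'; have := zP (y n).
rewrite !(metric_sym (y n)) => /le_trans; apply.
have := ler_wpM2l (_ : 0 <= 1 - t) nx; have := ler_wpM2l t0 nx'.
rewrite subr_ge0 => + /(_ t1); lra.
Qed.

Lemma bounded_seq_sub y (phi : nat -> nat) : bounded_seq y ->
  bounded_seq (y \o phi).
Proof. by move=> [a [M yM]]; exists a, M => k; exact: yM. Qed.

(** The filter inclusion says that whatever holds eventually along [phi] does so along [psi]. Unlike
    being a subsequence, it ignores finitely many terms, as diagonal sequences require. *)
Lemma radius_sub y (phi psi : nat -> nat) z : bounded_seq y ->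
  phi @ \oo `<=` psi @ \oo ->
  asym_radius (y \o psi) z <= asym_radius (y \o phi) z.
Proof.
move=> by_ sub; apply/(radius_leP _ _ (bounded_seq_sub psi by_)) => e e0.
apply: (sub [set k | mdist z (y k) <= asym_radius (y \o phi) z + e]).
exact: (radius_leP _ _ (bounded_seq_sub phi by_)).1 (lexx _) e e0.
Qed.

Lemma asymptotic_centerE y p : bounded_seq y ->
  (forall z, asym_radius y p ^+ 2 + mdist p z ^+ 2 <= asym_radius y z ^+ 2) ->
  asymptotic_center y = [set p].
Proof.
move=> by_ H; apply/seteqP; split => z /=; last first.
  move=> -> w; rewrite !asymptotic_radiusE// lee_fin.
  rewrite -(@ler_pXn2r _ 2) ?nnegrE ?radius_ge0//.
  by apply: le_trans (H w); rewrite lerDl exprn_ge0 ?mdist_ge0.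
move=> /(_ p); rewrite !asymptotic_radiusE// lee_fin.
rewrite -(@ler_pXn2r _ 2) ?nnegrE ?radius_ge0// => zp.
apply/esym/mdist_le0; rewrite -(@ler_pXn2r _ 2) ?nnegrE ?mdist_ge0//.
by rewrite expr0n/=; have := H z; lra.
Qed.

End AsymptoticRadius.

(** * Subsequences and diagonal extraction *)

Section StrictlyIncreasing.
Implicit Types phi psi : nat -> nat.

Lemma strictly_increasing_comp phi psi : strictly_increasing phi ->
  strictly_increasing psi -> strictly_increasing (phi \o psi).
Proof. by move=> phiS psiS i j ij; apply/phiS/psiS. Qed.

Lemma strictly_increasingS phi :
  (forall n, (phi n < phi n.+1)%N) -> strictly_increasing phi.
Proof.
move=> phiS i j; elim: j => // j IH; rewrite ltnS leq_eqVlt => /predU1P[->//|].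
by move=> /IH /ltn_trans; exact.
Qed.

Lemma strictly_increasing_ge phi n : strictly_increasing phi -> (n <= phi n)%N.
Proof. by move=> phiS; elim: n => // n IH; apply: leq_ltn_trans IH (phiS _ _ _). Qed.

Lemma strictly_increasing_cvg phi : strictly_increasing phi ->
  phi @ \oo --> \oo.
Proof.
move=> phiS P [N _ NP]; exists N => // n /= Nn; apply: NP => /=.
exact: leq_trans Nn (strictly_increasing_ge _ phiS).
Qed.

Lemma subseq_filter phi psi : strictly_increasing psi ->
  phi @ \oo `<=` (phi \o psi) @ \oo.
Proof. by move=> psiS P phiP; exact: (strictly_increasing_cvg psiS phiP). Qed.

(** At stage [k] a value is chosen above the previous one and in the ranges of [w 0], ..., [w k] at
    once; the inclusions say that late values of [w k] qualify. *)
Lemma diagonal_subsequence (w : nat -> nat -> nat) :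
  (forall n, strictly_increasing (w n)) ->
  (forall n, w n @ \oo `<=` w n.+1 @ \oo) ->
  exists2 d, strictly_increasing d & forall n, w n @ \oo `<=` d @ \oo.
Proof.
move=> wS sub.
have subn m n : (m <= n)%N -> w m @ \oo `<=` w n @ \oo.
  elim: n => [|n IH]; first by rewrite leqn0 => /eqP ->.
  by rewrite leq_eqVlt => /predU1P[->//|/IH h] P /h /sub.
have ex kN : exists v, (kN.2 < v)%N /\
    forall m, (m <= kN.1)%N -> exists i, v = w m i.
  case: kN => k N /=.
  have ranged m : (m <= k)%N -> \forall j \near \oo, exists i, w k j = w m i.
    move=> mk; apply: (subn m k mk [set v | exists i, v = w m i]).
    by exists 0%N => // i _; exists i.
  have all_ranged l : (l <= k)%N ->
      \forall j \near \oo, forall m, (m <= l)%N -> exists i, w k j = w m i.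
    elim: l => [|l IH] lk.
      by apply: filterS (ranged 0%N lk) => j ? m; rewrite leqn0 => /eqP ->.
    apply: filterS2 (ranged _ lk) (IH (ltnW lk)) => j h1 h2 m.
    by rewrite leq_eqVlt => /predU1P[->//|/h2].
  have [M _ MP] := all_ranged k (leqnn k).
  exists (w k (maxn M N.+1)); split; last by apply: MP; exact: leq_maxl.
  apply: leq_trans (strictly_increasing_ge _ (wS k)).
  exact: leq_maxr.
have [sel selP] := choice ex.
pose d := fix d n := if n is m.+1 then sel (m.+1, d m) else sel (0%N, 0%N).
have dS : strictly_increasing d.
  by apply: strictly_increasingS => n; exact: (selP (n.+1, d n)).1.
have dw m k : (m <= k)%N -> exists i, d k = w m i.
  by case: k => [|k] mk; exact: (selP _).2.
(* If [d k = w m i] with [i < N], then [d k < w m N <= k], against [k <= d k]. *)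
exists d => // m P [N _ NP]; exists (maxn m (w m N)) => // k /=.
rewrite geq_max => /andP[mk wk]; have [i di] := dw _ _ mk.
rewrite di; apply: NP => /=; rewrite leqNgt; apply/negP => /(wS m).
by rewrite -di ltnNge (leq_trans wk)// strictly_increasing_ge.
Qed.

(** Stage [n] refines the current subsequence until [rho] is within [1 / (n + 1)] of its infimum
    over all further refinements; the diagonal then cannot be lowered. Applied to the least
    asymptotic radius, this yields a regular subsequence. *)
Lemma extremal_subsequence (R : realType) (rho : (nat -> nat) -> R) :
  (forall phi, 0 <= rho phi) ->
  (forall phi psi, phi @ \oo `<=` psi @ \oo -> rho psi <= rho phi) ->
  exists2 d, strictly_increasing d &
    forall psi, strictly_increasing psi -> rho (d \o psi) = rho d.
Proof.
move=> rho0 mono.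
pose T := {phi | strictly_increasing phi}.
have ex (nw : nat * T) : exists w' : T, sval nw.2 @ \oo `<=` sval w' @ \oo /\
    forall v, strictly_increasing v -> sval nw.2 @ \oo `<=` v @ \oo ->
    rho (sval w') <= rho v + nw.1.+1%:R^-1.
  case: nw => n [w wS] /=.
  pose E := [set rho v | v in
    [set v | strictly_increasing v /\ w @ \oo `<=` v @ \oo]].
  have hE : has_inf E.
    split; first by exists (rho w), w => //; split.
    by exists 0 => _ [v _ <-].
  have n0 : 0 < n.+1%:R^-1 :> R by rewrite invr_gt0 ltr0n.
  have [_ [v [vS wv] <-] vlt] := inf_adherent n0 hE.
  exists (exist _ v vS); split => // v' v'S wv'.
  apply: (le_trans (ltW vlt)); rewrite lerD2r; apply: ge_inf; first exact: hE.2.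
  by exists v'.
have [step stepP] := choice ex.
have idS : strictly_increasing id by [].
pose W := fix W n : T := if n is m.+1 then step (m, W m) else exist _ id idS.
have [d dS Wd] := diagonal_subsequence (fun n => svalP (W n))
  (fun n => (stepP (n, W n)).1).
exists d => // psi psiS; have dpsi := subseq_filter (phi := d) psiS.
apply/eqP; rewrite eq_le mono//=; apply/ler_addgt0Pr => e e0.
have [N _ /(_ N (leqnn _)) /= NP] := near_infty_natSinv_lt (PosNum e0).
(* Since [d] refines [W N.+1] and [d \o psi] refines [W N], [rho d <= rho (W N.+1) <= rho (d \o psi)
   + 1 / (N + 1)]. *)
apply: (le_trans (mono _ _ (Wd N.+1))).
apply: le_trans ((stepP (N, W N)).2 (d \o psi) _ _) _.
- exact: strictly_increasing_comp.
- by move=> P /Wd /dpsi.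
- by rewrite lerD2l ltW.
Qed.

End StrictlyIncreasing.

(** * Delta-convergent subsequences and their limits *)

Section DeltaConvergence.
Context {R : realType} {X : completeMetricType R}.
Hypothesis cnX : @cn_space R X.
Implicit Types (y : nat -> X) (S : set X).

(** Along a regular subsequence [d] the least radius is that of each [d \o psi]. Hence [cen d]
    attains the least radius of [d \o psi], and quadratic growth identifies it with
    [cen (d \o psi)]. *)
Lemma bounded_Delta_subsequence y : bounded_seq y ->
  exists phi p, strictly_increasing phi /\ Delta_cvg (y \o phi) p.
Proof.
move=> by_; have b phi := bounded_seq_sub phi by_.
have ex (phi : nat -> nat) : exists p, forall z,
    asym_radius (y \o phi) p ^+ 2 + mdist p z ^+ 2 <=
    asym_radius (y \o phi) z ^+ 2.
  have [|||||p _ pP] := @strongly_convex_min R X setT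
    (fun z => asym_radius (y \o phi) z ^+ 2) cnX closedT.
  - by [].
  - by exists (y 0%N).
  - by move=> z; rewrite exprn_ge0 ?radius_ge0.
  - by move=> c; exact: closed_radius_sqr_le.
  - exact: radius_sqr_strongly_convex.
  by exists p => z; exact: pP.
have [cen cenP] := choice ex.
have cen_le (phi : nat -> nat) z :
    asym_radius (y \o phi) (cen phi) <= asym_radius (y \o phi) z.
  rewrite -(@ler_pXn2r _ 2) ?nnegrE ?radius_ge0//.
  by apply: le_trans (cenP phi z); rewrite lerDl exprn_ge0 ?mdist_ge0.
have [d dS dP] := @extremal_subsequence R
  (fun phi => asym_radius (y \o phi) (cen phi))
  (fun phi => radius_ge0 _ (b phi))
  (fun phi psi sub => le_trans (cen_le psi _) (radius_sub _ by_ sub)).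
exists d, (cen d); split => //; split; first exact: b.
move=> psi psiS.
rewrite -[_ \o psi]/(y \o (d \o psi)).
suff -> : cen d = cen (d \o psi) by exact: asymptotic_centerE.
apply/esym/mdist_le0; rewrite -(@ler_pXn2r _ 2) ?nnegrE ?mdist_ge0// expr0n/=.
have h : asym_radius (y \o (d \o psi)) (cen d) <=
    asym_radius (y \o (d \o psi)) (cen (d \o psi)).
  by rewrite dP//; apply: radius_sub => //; exact: subseq_filter.
have := cenP (d \o psi) (cen d).
have : asym_radius (y \o (d \o psi)) (cen d) ^+ 2 <=
    asym_radius (y \o (d \o psi)) (cen (d \o psi)) ^+ 2.
  by rewrite ler_pXn2r ?nnegrE ?radius_ge0.
lra.
Qed.

(** Were the nearest point [q] of [S] to [p] distinct from [p], the Pythagorean inequality would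
    give it a smaller asymptotic radius than the center [p]. *)
Lemma Delta_cvg_closed y p S : closed S -> cn_convex S ->
  (\forall n \near \oo, S (y n)) -> Delta_cvg y p -> S p.
Proof.
move=> cS convS Sy [by_ /(_ id) cenp].
have [N _ NS] := Sy.
have [q Sq qP] := nearest_point_exists p cnX cS convS
  (ex_intro _ (y N) (NS N (leqnn _))).
suff -> : p = q by [].
have pq : asym_radius y p <= asym_radius y q.
  have : asymptotic_center y p by rewrite [asymptotic_center _]cenp.
  by move/(_ q); rewrite !asymptotic_radiusE// lee_fin.
have : asym_radius y q ^+ 2 <= asym_radius y p ^+ 2 - mdist p q ^+ 2.
  apply/radius_sqr_leP => // e e0.
  have := (radius_sqr_leP p _ by_).1 (lexx _) e e0.
  by apply: filterS2 Sy => n /qP; lra.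
have : asym_radius y p ^+ 2 <= asym_radius y q ^+ 2.
  by rewrite ler_pXn2r ?nnegrE ?radius_ge0.
move=> h1 h2; apply/mdist_le0.
rewrite -(@ler_pXn2r _ 2) ?nnegrE ?mdist_ge0// expr0n/=.
lra.
Qed.

End DeltaConvergence.

(** * Common fixed points *)

Section FixedPoints.
Context {R : realType} {X : metricType R}.
Variables (C : set X) (T : X -> X).
Hypotheses (Cclosed : closed C) (HT : quasi_nonexpansive C T).

Lemma closed_fix_set : closed (fix_set C T).
Proof.
have [_ _ Tq] := HT.
move=> z cz; have Cz : C z by apply: Cclosed => B /cz [w [[Cw _] Bw]]; exists w.
split => //; apply: mdist_le0; apply/ler_addgt0Pr => e e0; rewrite add0r.
have e2 : 0 < e / 2 by rewrite divr_gt0.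
have [w [Fw]] := cz _ (nbhsx_ballx z _ e2); rewrite ballEmdist/= => zw.
have := Tq z w Cz Fw; have := metric_triangle (T z) w z.
by rewrite (metric_sym w z); lra.
Qed.

(** [T z] is no farther from [x] and [y] than [z] is, so the computation for uniqueness of (CN)
    points gives [T z = z]. *)
Lemma cn_convex_fix_set : cn_convex C -> cn_convex (fix_set C T).
Proof.
have [_ _ Tq] := HT.
move=> convC t x y z t01 Fx Fy zP.
have Cz : C z by exact: convC t01 Fx.1 Fy.1 zP.
split => //; apply: mdist_le0.
rewrite -(@ler_pXn2r _ 2) ?nnegrE ?mdist_ge0// expr0n/=.
have sq a b : 0 <= a -> a <= b -> a ^+ 2 <= b ^+ 2 :> R.
  by move=> a0 ab; rewrite ler_pXn2r ?nnegrE// (le_trans a0).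
have qx := sq _ _ (mdist_ge0 _ _) (Tq z x Cz Fx).
have qy := sq _ _ (mdist_ge0 _ _) (Tq z y Cz Fy).
have zx := zP x; have zy := zP y; have := zP (T z); move: t01 => /andP[t0 t1].
move: qx qy zx zy.
rewrite !mdistxx (metric_sym y x) (metric_sym z x) (metric_sym z y).
move: (mdist x z ^+ 2) (mdist y z ^+ 2) (mdist x y ^+ 2) => a b c.
move: (mdist (T z) x ^+ 2) (mdist (T z) y ^+ 2) => a' b'.
rewrite expr0n/= => qx qy h1 h2 h3; apply: (le_trans h3).
have t1' : 0 <= 1 - t by rewrite subr_ge0.
have := ler_wpM2l t1' (le_trans qx h1); have := ler_wpM2l t0 (le_trans qy h2).
lra.
Qed.

End FixedPoints.

(** * A recursive inequality for real sequences *)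

Section RealSequences.
Context {R : realType}.
Implicit Types a s b t : nat -> R.

Lemma dvg_partial_sums a : (forall k, 0 <= a k) ->
  (\sum_(0 <= k <oo) (a k)%:E = +oo)%E ->
  forall A, \forall n \near \oo, A <= \sum_(0 <= k < n) a k.
Proof.
move=> a0 sum_a; apply/cvgryPge/cvgeryP.
have -> : (fun n => (\sum_(0 <= k < n) a k)%:E) =
    (fun n => \sum_(0 <= k < n) (a k)%:E)%E.
  by apply/funext => n; rewrite sumEFin.
rewrite -sum_a; apply: is_cvg_nneseries => n _ _.
by rewrite lee_fin.
Qed.

(** The product of [t n] with [1 + A n - A N] stays below [t N], while the second factor
    diverges. *)
Lemma contraction_cvg0 a t N : (forall k, 0 < a k < 1) ->
  (\sum_(0 <= k <oo) (a k)%:E = +oo)%E -> (forall k, 0 <= t k) ->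
  (forall k, (N <= k)%N -> t k.+1 <= (1 - a k) * t k) ->
  t k @[k --> \oo] --> (0 : R).
Proof.
move=> a01 sum_a t0 tS.
pose A n := \sum_(0 <= k < n) a k.
have AS n : A n.+1 = A n + a n by rewrite /A big_nat_recr.
have A_ge n : A N <= A (N + n)%N.
  elim: n => [|n IH]; first by rewrite addn0.
  by rewrite addnS AS (le_trans IH)// lerDl ltW//; case/andP: (a01 (N + n)%N).
(* With [q = 1 + A n - A N >= 1]: [(1 - a) (q + a) <= q]. *)
have tA n : t (N + n)%N * (1 + A (N + n)%N - A N) <= t N.
  elim: n => [|n IH]; first by rewrite addn0 addrK mulr1.
  apply: le_trans IH; rewrite addnS AS.
  have := tS _ (leq_addr n N); have := A_ge n; have /andP[an0 an1] := a01 (N + n)%N.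
  have := t0 (N + n)%N.
  move: an0 an1; move: (t _) (t _) (A _) (A _) (a _) => u v w z c c0 c1 v0 zw uv.
  have h : 0 <= 1 + (w + c) - z by lra.
  apply: (le_trans (ler_wpM2r h uv)); rewrite -subr_ge0.
  rewrite (_ : _ - _ = v * (c * (w - z + c))); last by ring.
  by rewrite mulr_ge0// mulr_ge0 ?(ltW c0)//; lra.
apply/cvgrPdist_lt => e e0.
(* Beyond this threshold [t n >= e] would make the product at least [e + t N]. *)
have [M _ MP] := dvg_partial_sums (fun k => ltW (proj1 (andP (a01 k)))) sum_a
  (A N + t N / e).
exists (maxn M N) => // n /=; rewrite geq_max => /andP[Mn Nn].
rewrite sub0r normrN ger0_norm// ltNge; apply/negP => et.
have := tA (n - N)%N; rewrite subnKC// => h.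
have := MP n Mn; rewrite -/(A n) => An.
have : e * (1 + t N / e) <= t n * (1 + A n - A N).
  apply: ler_pM => //; [exact: ltW | | lra].
  by rewrite addr_ge0// divr_ge0// ltW.
rewrite mulrDr mulrCA divff ?gt_eqF// !mulr1; lra.
Qed.

(** The excess of [s] over [e / 2] contracts by [1 - a k] for large [k]. If [s] drops by at most
    [d], then [b k <= e / 2] and the recursion gives it; otherwise the drop exceeds
    [d >= a k * s k]. *)
Lemma recursive_inequality_cvg0 a s b M : (forall k, 0 < a k < 1) ->
  a k @[k --> \oo] --> (0 : R) -> (\sum_(0 <= k <oo) (a k)%:E = +oo)%E ->
  (forall k, 0 <= s k <= M) ->
  (forall k, s k.+1 <= (1 - a k) * s k + a k * b k) ->
  (forall e, 0 < e -> exists N d, 0 < d /\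
    forall k, (N <= k)%N -> s k - d <= s k.+1 -> b k <= e) ->
  s k @[k --> \oo] --> (0 : R).
Proof.
move=> a01 acvg sum_a sM sS H.
apply/cvgrPdist_lt => e e0.
have e2 : 0 < e / 2 by rewrite divr_gt0.
have [N [d [d0 Nd]]] := H _ e2.
have M0 : 0 <= M by case/andP: (sM 0%N); exact: le_trans.
have M1 : 0 < M + 1 by lra.
have dM : 0 < d / (M + 1) by rewrite divr_gt0.
move/cvgrPdist_lt/(_ _ dM) : (acvg) => [N' _ aN'].
have tS k : (maxn N N' <= k)%N ->
    Num.max 0 (s k.+1 - e / 2) <= (1 - a k) * Num.max 0 (s k - e / 2).
  rewrite geq_max => /andP[Nk N'k].
  have /andP[ak0 ak1] := a01 k; have /andP[sk0 skM] := sM k.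
  have ak1' : 0 <= 1 - a k by lra.
  rewrite ge_max; apply/andP; split.
    by rewrite mulr_ge0// le_max lexx.
  suff h : s k.+1 - e / 2 <= (1 - a k) * (s k - e / 2).
    by rewrite (le_trans h)// ler_wpM2l// le_max lexx orbT.
  have [sd|sd] := leP (s k - d) (s k.+1).
    have : a k * b k <= a k * (e / 2) by exact: ler_wpM2l (ltW ak0) _ _ (Nd k Nk sd).
    by have := sS k; lra.
  have adM : a k * (M + 1) <= d.
    have := aN' k N'k; rewrite /= sub0r normrN gtr0_norm// => /ltW.
    by rewrite ler_pdivlMr.
  have : a k * s k <= a k * (M + 1) by rewrite ler_wpM2l ?ltW//; lra.
  have : 0 <= a k * (e / 2) by rewrite mulr_ge0 ?ltW.
  lra.
have t0 k : 0 <= Num.max 0 (s k - e / 2) by rewrite le_max lexx.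
have /cvgrPdist_lt/(_ _ e2) := contraction_cvg0 a01 sum_a t0 tS.
apply: filterS => k; rewrite !sub0r !normrN !ger0_norm//; last by case/andP: (sM k).
by rewrite gt_max => /andP[_]; lra.
Qed.

End RealSequences.

(** * The Halpern iteration *)

(** [P] also depends on the rank [n], so that a tolerance can shrink along the subsequence. *)
Lemma frequently_subsequence (P : nat -> nat -> Prop) :
  (forall n N, exists2 k, (N <= k)%N & P n k) ->
  exists2 phi, strictly_increasing phi & forall n, P n (phi n).
Proof.
move=> H.
have ex nN : exists k, (nN.2 <= k)%N /\ P nN.1 k.
  by have [k] := H nN.1 nN.2; exists k.
have [sel selP] := choice ex.
pose phi := fix phi n := if n is m.+1 then sel (m.+1, (phi m).+1) else sel (0, 0)%N.
exists phi; first by apply: strictly_increasingS => n; exact: (selP (n.+1, _)).1.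
by case=> [|n]; [exact: (selP (0, 0)%N).2|exact: (selP (n.+1, _)).2].
Qed.

Section StronglyQuasiNonexpansive.
Context {R : realType} {X : completeMetricType R}.
Hypothesis cnX : @cn_space R X.
Variables (C : set X) (T : nat -> X -> X).
Hypotheses (Cclosed : closed C) (convC : cn_convex C).
Hypotheses (HT : strongly_quasi_nonexpansive_seq C T)
  (HD : demiclosedness_condition C T).

Let F := common_fix_set C T.

Let Tquasi k : quasi_nonexpansive C (T k).
Proof. by have [/(_ k)] := HT. Qed.

Lemma closed_common_fix_set : closed F.
Proof. by apply: closed_bigI => k _; exact: closed_fix_set (Tquasi k). Qed.

Lemma cn_convex_common_fix_set : cn_convex F.
Proof.
move=> t x y z t01 Fx Fy zP k _.
by apply: cn_convex_fix_set zP => //; [exact: Fx|exact: Fy].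
Qed.

(* Off the indices [phi j] the sequence is padded with the common fixed point
   [p], so that the hypothesis on full sequences applies. *)
Lemma subsequence_residual_cvg0 (x : nat -> X) phi p : F p ->
  (forall k, C (x k)) -> bounded_seq x -> strictly_increasing phi ->
  mdist (x (phi j)) p - mdist (T (phi j) (x (phi j))) p @[j --> \oo] --> (0 : R) ->
  mdist (x (phi j)) (T (phi j) (x (phi j))) @[j --> \oo] --> (0 : R).
Proof.
move=> Fp Cx [a [M xM]] phiS /cvgrPdist_lt dcvg.
pose y k := if `[< exists j, k = phi j >] then x k else p.
have yphi j : y (phi j) = x (phi j).
  by rewrite /y; case: asboolP => // -[]; exists j.
have Cy k : C (y k).
  by rewrite /y; case: asboolP => // _; exact: (Fp 0%N I).1.
have by_ : bounded_seq y.
  exists a, (Num.max M (mdist a p)) => k; rewrite /y; case: asboolP => _.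
    by rewrite le_max xM.
  by rewrite le_max lexx orbT.
have ydiff : exists2 q, F q &
    (mdist (y k) q - mdist (T k (y k)) q) @[k --> \oo] --> (0 : R).
  exists p => //; apply/cvgrPdist_lt => e e0; have [J _ JP] := dcvg e e0.
  (* An index [k >= phi J] in the range of [phi] is some [phi j] with [j >= J]; at the others the
     difference vanishes because [p] is fixed. *)
  exists (phi J) => // k /= Jk.
  have [[j kj]|nk] := pselect (exists j, k = phi j).
    rewrite kj yphi; apply: JP => /=; rewrite leqNgt; apply/negP => /phiS.
    by rewrite -kj ltnNge Jk.
  rewrite /y; case: asboolP => // _; rewrite (Fp k I).2 mdistxx subrr subrr.
  by rewrite normr0.
have [_ _ /(_ y Cy by_ ydiff) ycvg] := HT.
have : mdist (y (phi j)) (T (phi j) (y (phi j))) @[j --> \oo] --> (0 : R).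
  exact: cvg_comp (strictly_increasing_cvg phiS) ycvg.
by under eq_fun do rewrite yphi.
Qed.

Section Halpern.
Variables (u p : X) (alpha : nat -> R) (x : nat -> X).
Hypotheses (Cu : C u) (Fp : F p)
  (p_min : forall q, F q -> mdist u p <= mdist u q).
Hypothesis alpha01 : forall k, 0 < alpha k < 1.
Hypothesis alpha0 : alpha k @[k --> \oo] --> (0 : R).
Hypothesis Cx0 : C (x 0%N).
Hypothesis xS : forall k, cn_point (1 - alpha k) u (T k (x k)) (x k.+1).

(** Radius of a ball about [p] containing [u] and [x 0]; convexity of balls keeps the whole orbit
    inside. *)
Let K := Num.max (mdist p u) (mdist p (x 0%N)).

Let alpha01' k : 0 <= 1 - alpha k <= 1.
Proof. by have /andP[] := alpha01 k; lra. Qed.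

Lemma halpern_mem k : C (x k).
Proof.
elim: k => // k IH; apply: convC (alpha01' k) Cu _ (xS k).
by have [TC _ _] := Tquasi k; exact: TC.
Qed.

Lemma halpern_nonexpansive k : mdist p (T k (x k)) <= mdist p (x k).
Proof.
have [_ _] := Tquasi k; rewrite !(metric_sym p).
by apply; [exact: halpern_mem | exact: Fp].
Qed.

Lemma halpern_bounded k : mdist p (x k) <= K.
Proof.
elim: k => [|k IH]; first by rewrite le_max lexx orbT.
apply: (cn_convex_ball (alpha01' k) _ _ (xS k)) => /=.
  by rewrite le_max lexx.
exact: le_trans (halpern_nonexpansive k) IH.
Qed.

Let b k := mdist u p ^+ 2 - (1 - alpha k) * mdist u (T k (x k)) ^+ 2.

Lemma halpern_recursive_inequality k : mdist p (x k.+1) ^+ 2 <=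
  (1 - alpha k) * mdist p (T k (x k)) ^+ 2 + alpha k * b k.
Proof.
have := xS k p; rewrite /b (metric_sym p u); lra.
Qed.

(** The recursion bounds [d(p, x k)^2 - d(p, T k (x k))^2] by [1 / (j + 1) + alpha k * d(u, p)^2] at
    [k = phi j]. So the distances to [p] before and after [T k] merge, and strong
    quasi-nonexpansiveness applies. *)
Lemma halpern_residual phi : strictly_increasing phi ->
  (forall j, mdist p (x (phi j)) ^+ 2 - j.+1%:R^-1 <=
             mdist p (x (phi j).+1) ^+ 2) ->
  mdist (x (phi j)) (T (phi j) (x (phi j))) @[j --> \oo] --> (0 : R).
Proof.
move=> phiS phiP; apply: (subsequence_residual_cvg0 Fp) => //.
- exact: halpern_mem.
- by exists p, K; exact: halpern_bounded.
apply/cvgrPdist_lt => e e0.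
have e2 : 0 < e ^+ 2 / 2 by rewrite divr_gt0 ?exprn_gt0.
pose D := mdist u p ^+ 2; have D0 : 0 <= D by rewrite exprn_ge0 ?mdist_ge0.
have D1 : 0 < D + 1 by lra.
have eD : 0 < e ^+ 2 / 2 / (D + 1) by rewrite divr_gt0.
have /cvgrPdist_lt/(_ _ eD) := cvg_comp _ _ (strictly_increasing_cvg phiS) alpha0.
apply: filterS2 (near_infty_natSinv_lt (PosNum e2)) => j /=.
rewrite sub0r normrN; move: (phi j) (phiP j) => k kP jE.
have /andP[a0 a1] := alpha01 k; rewrite gtr0_norm// ltr_pdivlMr// => aE.
rewrite !(metric_sym _ p) sub0r normrN ger0_norm ?subr_ge0 ?halpern_nonexpansive//.
rewrite -(@ltr_pXn2r _ 2) ?nnegrE ?subr_ge0 ?halpern_nonexpansive ?ltW//.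
have := halpern_recursive_inequality k; rewrite /b -/D.
have t0 : 0 <= mdist p (T k (x k)) by exact: mdist_ge0.
have ts : mdist p (T k (x k)) <= mdist p (x k) := halpern_nonexpansive k.
have : 0 <= alpha k * mdist p (T k (x k)) ^+ 2.
  by rewrite mulr_ge0 ?exprn_ge0// ltW.
have : 0 <= alpha k * ((1 - alpha k) * mdist u (T k (x k)) ^+ 2).
  by rewrite !mulr_ge0 ?exprn_ge0 ?mdist_ge0 ?subr_ge0 ?ltW.
(* For [0 <= t <= s], [(s - t)^2 <= (s - t) (s + t)]. *)
have : (mdist p (x k) - mdist p (T k (x k))) ^+ 2 <=
    mdist p (x k) ^+ 2 - mdist p (T k (x k)) ^+ 2.
  by rewrite subr_sqr expr2 ler_wpM2l ?subr_ge0//; lra.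
move: (mdist p (x k.+1) ^+ 2) kP jE => s' kP jE h1 h2 h3 h4.
move: (mdist p (T k (x k)) ^+ 2) (mdist p (x k) ^+ 2) (j.+1%:R^-1)
  ((_ - _) ^+ 2) (mdist u (T k (x k)) ^+ 2) kP jE h1 h2 h3 h4 => *.
lra.
Qed.

(** From [b k > e] one gets [d(u, T k (x k))^2 < D - e + alpha k * L^2], eventually below
    [D - e / 2]; the vanishing residual carries the gap over to [x k]. *)
Lemma halpern_far_subsequence phi e : 0 < e -> strictly_increasing phi ->
  mdist (x (phi j)) (T (phi j) (x (phi j))) @[j --> \oo] --> (0 : R) ->
  (forall j, e < b (phi j)) -> exists2 r, r < mdist u p &
    \forall j \near \oo, mdist u (x (phi j)) <= r.
Proof.
move=> e0 phiS res bP.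
pose D := mdist u p ^+ 2; have D0 : 0 <= D by rewrite exprn_ge0 ?mdist_ge0.
pose L := mdist u p + K.
have vL k : mdist u (T k (x k)) <= L.
  apply: (le_trans (metric_triangle _ p _)); rewrite lerD2l.
  exact: le_trans (halpern_nonexpansive k) (halpern_bounded k).
have L0 : 0 <= L := le_trans (mdist_ge0 _ _) (vL 0%N).
have eL : 0 < e / 2 / (L ^+ 2 + 1).
  by rewrite divr_gt0// ?divr_gt0// ltr_pwDr// exprn_ge0.
have e2 : e / 2 <= D.
  have := bP 0%N; rewrite /b -/D.
  have : 0 <= (1 - alpha (phi 0%N)) * mdist u (T (phi 0%N) (x (phi 0%N))) ^+ 2.
    by rewrite mulr_ge0 ?exprn_ge0 ?mdist_ge0//; case/andP: (alpha01' (phi 0%N)).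
  lra.
pose r0 := Num.sqrt (D - e / 2).
have r0E : r0 ^+ 2 = D - e / 2 by rewrite sqr_sqrtr// subr_ge0.
have r0_lt : r0 < mdist u p.
  rewrite -(@ltr_pXn2r _ 2) ?nnegrE ?sqrtr_ge0 ?mdist_ge0// r0E -/D; lra.
(* Half of the gap is spent on the residual, the other half keeps [r0 + d] strictly below
   [d(u, p)]. *)
pose d := (mdist u p - r0) / 2.
have d0 : 0 < d by rewrite divr_gt0// subr_gt0.
exists (r0 + d); first by rewrite /d; lra.
move/cvgrPdist_lt/(_ _ d0) : res => res.
have /cvgrPdist_lt/(_ _ eL) := cvg_comp _ _ (strictly_increasing_cvg phiS) alpha0.
apply: filterS2 res => j /=; rewrite !sub0r !normrN ger0_norm ?mdist_ge0//.
move: (bP j); move: (phi j) => k; rewrite /b -/D => kP xT.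
have /andP[a0 a1] := alpha01 k; rewrite gtr0_norm// ltr_pdivlMr; last first.
  by rewrite ltr_pwDr// exprn_ge0.
move=> aL.
have vr : mdist u (T k (x k)) <= r0.
  rewrite -(@ler_pXn2r _ 2) ?nnegrE ?sqrtr_ge0 ?mdist_ge0// r0E.
  have : mdist u (T k (x k)) ^+ 2 <= L ^+ 2.
    by rewrite ler_pXn2r ?nnegrE ?mdist_ge0.
  move/(ler_wpM2l (ltW a0)); lra.
have := metric_triangle u (T k (x k)) (x k).
by rewrite (metric_sym (T k (x k))); lra.
Qed.

Lemma halpern_near_decrease e : 0 < e -> exists N d, 0 < d /\
  forall k, (N <= k)%N ->
    mdist p (x k) ^+ 2 - d <= mdist p (x k.+1) ^+ 2 -> b k <= e.
Proof.
move=> e0; apply: contrapT => H.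
have [|phi phiS phiP] := @frequently_subsequence (fun n k =>
    mdist p (x k) ^+ 2 - n.+1%:R^-1 <= mdist p (x k.+1) ^+ 2 /\ e < b k).
  move=> n N; apply: contrapT => nex; apply: H; exists N, (n.+1%:R^-1).
  split; first by rewrite invr_gt0 ltr0n.
  move=> k Nk dk; rewrite leNgt; apply/negP => ek.
  by apply: nex; exists k.
have res := halpern_residual phiS (fun j => (phiP j).1).
have [r rp xr] := halpern_far_subsequence e0 phiS res (fun j => (phiP j).2).
have bx : bounded_seq (x \o phi).
  by exists p, K => k; exact: halpern_bounded.
have [psi [q [psiS qP]]] := bounded_Delta_subsequence cnX bx.
have Cq : C q.
  by apply: (Delta_cvg_closed cnX Cclosed convC _ qP); near=> n; exact: halpern_mem.
have Fq : F q.
  apply: (HD halpern_mem (strictly_increasing_comp phiS psiS) Cq qP).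
  exact: cvg_comp (strictly_increasing_cvg psiS) res.
(* The closed ball about [u] keeps its Delta-limits, which replaces weak lower semicontinuity of the
   distance; [q] is then a common fixed point nearer to [u] than [p]. *)
have : mdist u q <= r.
  apply: (Delta_cvg_closed cnX (closed_ball_mdist (r := r)) _ _ qP).
    exact: cn_convex_ball.
  exact: (strictly_increasing_cvg psiS xr).
by move=> /(le_trans (p_min Fq)); rewrite leNgt rp.
Unshelve. all: by end_near. Qed.

Lemma halpern_cvg : (\sum_(0 <= k <oo) (alpha k)%:E = +oo)%E ->
  x k @[k --> \oo] --> p.
Proof.
move=> sum_alpha.
have /cvgrPdist_lt s0 : mdist p (x k) ^+ 2 @[k --> \oo] --> (0 : R).
  apply: (@recursive_inequality_cvg0 _ alpha _ b (K ^+ 2)) => // [k|k|].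
  - rewrite exprn_ge0 ?mdist_ge0//= ler_pXn2r ?nnegrE ?mdist_ge0 ?halpern_bounded//.
    exact: le_trans (mdist_ge0 _ _) (halpern_bounded 0).
  - apply: (le_trans (halpern_recursive_inequality k)); rewrite lerD2r.
    rewrite ler_wpM2l//; first by case/andP: (alpha01' k).
    by rewrite ler_pXn2r ?nnegrE ?mdist_ge0 ?halpern_nonexpansive.
  - exact: halpern_near_decrease.
apply/metricType_numDomainType.cvgrPdist_lt => e e0.
apply: filterS (s0 _ (exprn_gt0 2 e0)) => k.
rewrite sub0r normrN ger0_norm ?exprn_ge0 ?mdist_ge0//.
by rewrite ltr_pXn2r ?nnegrE ?mdist_ge0 ?ltW.
Qed.

End Halpern.
End StronglyQuasiNonexpansive.

Theorem theorem2p3 (R : realType) (X : completeMetricType R)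
    (HX : cat0 X)
    (C : set X) (Cclosed : closed C) (Cconvex : geodesically_convex C)
    (T : nat -> X -> X)
    (HT : strongly_quasi_nonexpansive_seq C T)
    (HD : demiclosedness_condition C T)
    (u : X) (Cu : C u)
    (alpha : nat -> R)
    (alpha01 : forall k, 0 < alpha k < 1)
    (alpha0 : alpha k @[k --> \oo] --> (0 : R))
    (sum_alpha : (\sum_(0 <= k <oo) (alpha k)%:E = +oo)%E)
    (x : nat -> X) (Cx0 : C (x 0%N))
    (xS : forall k, comb (1 - alpha k) u (T k (x k)) (x k.+1)) :
  exists2 p, is_proj (common_fix_set C T) u p & x k @[k --> \oo] --> p.
Proof.
have cnX := cat0_cn_space HX; have convC := geodesically_convex_cn HX Cconvex.
have [_ F0 _] := HT.
have [p Fp pP] := nearest_point_exists u cnX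
  (closed_common_fix_set Cclosed HT) (cn_convex_common_fix_set convC HT) F0.
have p_min q : common_fix_set C T q -> mdist u p <= mdist u q.
  move=> /pP pq; rewrite -(@ler_pXn2r _ 2) ?nnegrE ?mdist_ge0//.
  by apply: le_trans pq; rewrite lerDl exprn_ge0 ?mdist_ge0.
exists p.
  (* For another nearest point [z], the Pythagorean inequality gives [d(u, p)^2 + d(p, z)^2 <= d(u,
     z)^2 <= d(u, p)^2]. *)
  apply/seteqP; split => [z [/pP pz /(_ p Fp) zp]|z ->] /=; last by [].
  apply/esym/mdist_le0; rewrite -(@ler_pXn2r _ 2) ?nnegrE ?mdist_ge0// expr0n/=.
  have : mdist u z ^+ 2 <= mdist u p ^+ 2 by rewrite ler_pXn2r ?nnegrE ?mdist_ge0.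
  lra.
apply: (halpern_cvg cnX Cclosed convC HT HD Cu Fp p_min alpha01 alpha0 Cx0) => //.
move=> k; apply: comb_cn_point (xS k) => //.
by have /andP[] := alpha01 k; lra.
Qed.
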